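(* Let $d\ge2$ (with $d<[K[\chi]:K]$) and let $\nu'\le\nu$ be pm valuations on $K[\chi]$. Assume that $\chi^d$ is limit over $(K_{d-1}[\chi],\nu)$, that the restrictions of $\nu$ and $\nu'$ to $K_{d-1}[\chi]$ are equal, and that there exists a monic polynomial $\Phi$ of degree $d$ such that $\nu'(\Phi)<\nu(\Phi)$. Let $(\Phi_i)$ be a sequence of monic polynomials of degree $d$ such that the sequence $(\nu(\Phi_i))$ is increasing and cofinal in $\nu K[\chi]$, and $\nu(\Phi)<\nu(\Phi_i)$. Then: 1) $d$ is an immediate key degree for $\nu$, $\Phi$ is a w key polynomial for $\nu$ and $\nu'$, and $\nu'=\nu'_\Phi$. 2) The $\Phi_i$'s are key polynomials for $\nu$, and for every $f\in K[\chi]$ the sequence $(\nu_{\Phi_i}(f))$ is eventually equal to $\nu(f)$. 3) The extension $(K[\chi]|K_{d-1}[\chi],\nu)$ is dense. 4) There is no key degree (for $\nu$) greater than $d$.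
   Context: $K$ is a field, $\chi\notin K$ is algebraic or transcendental over $K$; $[K[\chi]:K]=\infty$ if $\chi$ is transcendental. When $\chi$ is algebraic, elements of $K[\chi]$ are written uniquely as polynomials in $\chi$ of degree $<[K[\chi]:K]$. $K_m[\chi]$ is the $K$-module of polynomials of degree at most $m$. A $K$-module valuation is a map $\nu$ to $\Gamma\cup\{\infty\}$, $\Gamma$ a linearly ordered abelian group, such that $\nu(y)=\infty\Leftrightarrow y=0$, $\nu(y_1+y_2)\ge\min(\nu(y_1),\nu(y_2))$ and $\nu(xy)=\nu(x)+\nu(y)$ for $x\in K$. It is a pm (partially multiplicative) valuation if $\nu(fg)=\nu(f)+\nu(g)$ for all $f,g\in K[\chi]$ with $\deg(f)+\deg(g)<[K[\chi]:K]$; if $\chi$ is transcendental one requires moreover that $\nu$ is a field valuation on $K(\chi)$. It is assumed that $\nu K$ has finite rank. $\nu'\le\nu$ means $\nu'(f)\le\nu(f)$ for all $f\in K[\chi]$. For a set $S$, $\nu S=\{\nu(s):s\in S\}\setminus\{\infty\}$, and $\nu(l-M)=\{\nu(l-x):x\in M\}\setminus\{\infty\}$. It is assumed that $\nu M$ has no greatest element for the $K$-modules $M$ considered (true if $\nu K$ is non-trivial). An element $l$ is limit over $(M,\nu)$ if $\nu(l-M)=\nu M$; for $K$-modules $M\subseteq N$, $(N|M,\nu)$ is dense if every element of $N$ is limit over $(M,\nu)$. For $\Phi$ monic of degree $d$, $1\le d<[K[\chi]:K]$, and $f,g\in K_{d-1}[\chi]$, $q_\Phi(f,g)$ and $r_\Phi(f,g)$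 are the quotient and remainder of the euclidean division of $fg$ by $\Phi$. $\Phi$ is a w key polynomial (resp. a key polynomial) for $\nu$ if $\nu(fg)=\nu(r_\Phi(f,g))$ (resp. $\nu(fg)=\nu(r_\Phi(f,g))<\nu(q_\Phi(f,g)\Phi)$) for all nonzero $f,g\in K_{d-1}[\chi]$ with $\deg(f)+\deg(g)<[K[\chi]:K]$. $d$ is a key degree for $\nu$ if there is a key polynomial of degree $d$ for $\nu$; it is immediate if moreover $\nu(\chi^d-K_{d-1}[\chi])$ has no maximal element. For $\Phi$ monic of degree $d$ and $f=f_0+f_1\Phi+\cdots+f_m\Phi^m$ with $f_i\in K_{d-1}[\chi]$, $\deg(f_m)+dm<[K[\chi]:K]$, set $\nu_\Phi(f):=\min_{0\le i\le m}(\nu(f_i)+i\nu(\Phi))$; $\nu'_\Phi$ is defined likewise from $\nu'$. *)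

(* Defs.v *)
From HB Require Import structures.
From mathcomp Require Import all_boot all_order all_algebra.
From mathcomp Require Import mathcomp_extra boolp classical_sets functions.
From mathcomp Require Import cardinality.

Set Implicit Arguments.
Unset Strict Implicit.
Unset Printing Implicit Defensive.

Import Order.TTheory GRing.Theory Num.Theory.
Local Open Scope classical_set_scope.
Local Open Scope ring_scope.

HB.mixin Record isOrderedGroup G of Num.POrderedZmodule G := {
  oag_le_total : total (<=%O : rel G);
  oag_leD2r : forall z x y : G, x <= y -> x + z <= y + z
}.

#[short(type="oagType")]
HB.structure Definition OrderedGroup :=
  { G of Num.POrderedZmodule G & isOrderedGroup G }.

(* Gamma with a greatest, absorbing element infinity adjoined: Some g is the
   value g, and None is infinity. *)
Definition withinf (G : Type) : Type := option G.

HB.instance Definition _ (G : choiceType) :=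
  Choice.copy (withinf G) (option G).

Definition withinf_le (G : oagType) (x y : withinf G) : bool :=
  match x, y with
  | _, None => true
  | None, Some _ => false
  | Some a, Some b => a <= b
  end.

Definition withinf_add (G : oagType) (x y : withinf G) : withinf G :=
  match x, y with
  | Some a, Some b => Some (a + b)
  | _, _ => None
  end.

Fact withinf_le_refl (G : oagType) : reflexive (@withinf_le G).
Proof. by case=> [x|] /=. Qed.

Fact withinf_le_anti (G : oagType) : antisymmetric (@withinf_le G).
Proof. by case=> [x|] [y|] //= /le_anti ->. Qed.

Fact withinf_le_trans (G : oagType) : transitive (@withinf_le G).
Proof. by case=> [y|] [x|] [z|] //=; apply: le_trans. Qed.

HB.instance Definition _ (G : oagType) :=
  Order.Le_isPOrder.Build ring_display (withinf G) (@withinf_le_refl G)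
    (@withinf_le_anti G) (@withinf_le_trans G).

Fact withinf_le_total (G : oagType) : total (<=%O : rel (withinf G)).
Proof. by case=> [x|] [y|] //; apply: oag_le_total. Qed.

HB.instance Definition _ (G : oagType) :=
  Order.POrder_isTotal.Build ring_display (withinf G) (@withinf_le_total G).

Fact withinf_le_top (G : oagType) (x : withinf G) : x <= None.
Proof. by case: x. Qed.

HB.instance Definition _ (G : oagType) :=
  Order.hasTop.Build ring_display (withinf G) (@withinf_le_top G).

Fact withinf_addA (G : oagType) : associative (@withinf_add G).
Proof. by case=> [x|] [y|] [z|] //=; rewrite addrA. Qed.

Fact withinf_addC (G : oagType) : commutative (@withinf_add G).
Proof. by case=> [x|] [y|] //=; rewrite addrC. Qed.

Fact withinf_add0 (G : oagType) : left_id (Some 0) (@withinf_add G).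
Proof. by case=> [x|] //=; rewrite add0r. Qed.

HB.instance Definition _ (G : oagType) :=
  GRing.isNmodule.Build (withinf G) (@withinf_addA G) (@withinf_addC G)
    (@withinf_add0 G).

(* The field extension is given by a field morphism iota : K -> L and an
   element chi of L; a polynomial f in {poly K} stands for the element f(chi)
   of K[chi]. *)
Definition evchi (K L : fieldType) (iota : {rmorphism K -> L}) (chi : L)
  (f : {poly K}) : L := (map_poly iota f).[chi].

Definition Kchi (K L : fieldType) (iota : {rmorphism K -> L}) (chi : L) :
  set L := [set evchi iota chi f | f in setT].

(* K(chi); 0 is its own inverse in L. *)
Definition Kchi_frac (K L : fieldType) (iota : {rmorphism K -> L}) (chi : L) :
  set L := [set y / z | y in Kchi iota chi & z in Kchi iota chi].

(* deg 0 = 0, which makes no difference below. *)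
Definition deg (K : fieldType) (f : {poly K}) : nat := (size f).-1.

(* K_m[chi] *)
Definition Kchi_le (K L : fieldType) (iota : {rmorphism K -> L}) (chi : L)
  (m : nat) : set L :=
  [set evchi iota chi f | f in [set f : {poly K} | (deg f <= m)%N]].

(* m < [K[chi] : K]: there are m + 1 elements of K[chi] which are linearly
   independent over K. *)
Definition lt_extdeg (K L : fieldType) (iota : {rmorphism K -> L}) (chi : L)
  (m : nat) : Prop :=
  exists2 b : 'I_m.+1 -> L, (forall i, Kchi iota chi (b i)) &
    forall c : 'I_m.+1 -> K,
      \sum_(i < m.+1) iota (c i) * b i = 0 -> forall i, c i = 0.

Definition Ksubmodule (K L : fieldType) (iota : {rmorphism K -> L})
  (M : set L) : Prop :=
  [/\ M 0, forall y z, M y -> M z -> M (y + z) &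
      forall x y, M y -> M (iota x * y)].

Definition module_valuation (K L : fieldType) (iota : {rmorphism K -> L})
  (G : oagType) (M : set L) (nu : L -> withinf G) : Prop :=
  [/\ forall y, M y -> (nu y = None <-> y = 0),
      forall y z, M y -> M z -> Order.min (nu y) (nu z) <= nu (y + z) &
      forall x y, M y -> nu (iota x * y) = nu (iota x) + nu y].

Definition field_valuation (L : fieldType) (G : oagType) (F : set L)
  (nu : L -> withinf G) : Prop :=
  [/\ forall y, F y -> (nu y = None <-> y = 0),
      forall y z, F y -> F z -> Order.min (nu y) (nu z) <= nu (y + z) &
      forall y z, F y -> F z -> nu (y * z) = nu y + nu z].

Definition pm_valuation (K L : fieldType) (iota : {rmorphism K -> L}) (chi : L)
  (G : oagType) (nu : L -> withinf G) : Prop :=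
  [/\ module_valuation iota (Kchi iota chi) nu,
      forall f g : {poly K}, lt_extdeg iota chi (deg f + deg g) ->
        nu (evchi iota chi (f * g)) =
          nu (evchi iota chi f) + nu (evchi iota chi g) &
      ~ algebraicOver iota chi -> field_valuation (Kchi_frac iota chi) nu].

(* nu S, infinity being removed. *)
Definition values (L : fieldType) (G : oagType) (nu : L -> withinf G)
  (S : set L) : set G := [set g | exists2 s, S s & nu s = Some g].

Definition has_greatest (G : oagType) (A : set G) : Prop :=
  exists2 g, A g & forall h, A h -> h <= g.

Definition convex_subgroup (G : oagType) (A H : set G) : Prop :=
  [/\ H `<=` A, H 0, forall x y, H x -> H y -> H (x - y) &
      forall x y, H y -> A x -> 0 <= x -> x <= y -> H x].

Definition finite_rank (G : oagType) (A : set G) : Prop :=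
  finite_set [set H : set G | convex_subgroup A H].

Definition translate (L : fieldType) (l : L) (M : set L) : set L :=
  [set l - x | x in M].

Definition limit_over (L : fieldType) (G : oagType) (nu : L -> withinf G)
  (M : set L) (l : L) : Prop := values nu (translate l M) = values nu M.

Definition dense (L : fieldType) (G : oagType) (nu : L -> withinf G)
  (N M : set L) : Prop := M `<=` N /\ forall l, N l -> limit_over nu M l.

Definition w_key_polynomial (K L : fieldType) (iota : {rmorphism K -> L})
  (chi : L) (G : oagType) (nu : L -> withinf G) (Phi : {poly K}) : Prop :=
  [/\ Phi \is monic, (1 <= deg Phi)%N, lt_extdeg iota chi (deg Phi) &
      forall f g : {poly K}, f != 0 -> g != 0 ->
        (deg f < deg Phi)%N -> (deg g < deg Phi)%N ->
        lt_extdeg iota chi (deg f + deg g) ->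
        nu (evchi iota chi (f * g)) = nu (evchi iota chi ((f * g) %% Phi))].

Definition key_polynomial (K L : fieldType) (iota : {rmorphism K -> L})
  (chi : L) (G : oagType) (nu : L -> withinf G) (Phi : {poly K}) : Prop :=
  [/\ Phi \is monic, (1 <= deg Phi)%N, lt_extdeg iota chi (deg Phi) &
      forall f g : {poly K}, f != 0 -> g != 0 ->
        (deg f < deg Phi)%N -> (deg g < deg Phi)%N ->
        lt_extdeg iota chi (deg f + deg g) ->
        nu (evchi iota chi (f * g)) = nu (evchi iota chi ((f * g) %% Phi)) /\
        nu (evchi iota chi ((f * g) %% Phi)) <
          nu (evchi iota chi ((f * g) %/ Phi * Phi))].

Definition key_degree (K L : fieldType) (iota : {rmorphism K -> L}) (chi : L)
  (G : oagType) (nu : L -> withinf G) (d : nat) : Prop :=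
  exists2 Phi : {poly K}, key_polynomial iota chi nu Phi & deg Phi = d.

Definition immediate_key_degree (K L : fieldType) (iota : {rmorphism K -> L})
  (chi : L) (G : oagType) (nu : L -> withinf G) (d : nat) : Prop :=
  key_degree iota chi nu d /\
  ~ has_greatest (values nu (translate (chi ^+ d) (Kchi_le iota chi d.-1))).

(* f = \sum_i digit Phi f i * Phi ^+ i for nonconstant monic Phi (see
   digitE). *)
Definition digit (K : fieldType) (Phi f : {poly K}) (i : nat) : {poly K} :=
  (f %/ Phi ^+ i) %% Phi.

(* nu_Phi(f). The digits of index at least size f are zero, hence contribute
   infinity to the minimum, as do all other zero digits. *)
Definition nu_sub (K L : fieldType) (iota : {rmorphism K -> L}) (chi : L)
  (G : oagType) (nu : L -> withinf G) (Phi f : {poly K}) : withinf G :=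
  \big[Order.min/None]_(i < size f)
    (nu (evchi iota chi (digit Phi f i)) + nu (evchi iota chi Phi) *+ i).

Lemma size_digit (K : fieldType) (Phi f : {poly K}) (i : nat) :
  (0 < deg Phi)%N -> (size (digit Phi f i) <= deg Phi)%N.
Proof.
rewrite /deg => dPhi; have sPhi : (0 < size Phi)%N by case: (size Phi) dPhi.
by rewrite -ltnS prednK // ltn_modp -size_poly_gt0.
Qed.

Lemma digitE (K : fieldType) (Phi f : {poly K}) :
  Phi \is monic -> (0 < deg Phi)%N ->
  f = \sum_(i < size f) digit Phi f i * Phi ^+ i.
Proof.
move=> mPhi dPhi.
have H m : f = \sum_(i < m) digit Phi f i * Phi ^+ i
               + f %/ Phi ^+ m * Phi ^+ m.
  elim: m => [|m IHm]; first by rewrite big_ord0 add0r expr0 divp1 mulr1.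
  rewrite {1}IHm big_ord_recr /= -addrA; congr (_ + _).
  rewrite [Phi ^+ m.+1]exprSr -divp_divl [_ ^+ m * Phi]mulrC mulrA -mulrDl.
  by congr (_ * _); rewrite {1}(divp_eq (f %/ Phi ^+ m) Phi) addrC.
have := H (size f); rewrite [f %/ _]divp_small ?mul0r ?addr0 //.
have P0 : (0 < size (Phi ^+ size f)%R)%N.
  by rewrite size_poly_gt0 expf_neq0 // monic_neq0.
by rewrite -(prednK P0) ltnS size_exp leq_pmull.
Qed.

(* Main.v *)
(* Since nu' < nu at every Phi_i while nu' = nu in degree < d, in f = q Phi_i + r
   the two terms cannot cancel for nu'; hence nu'(f) = min (nu'(q Phi_i), nu'(r)),
   which gives the key polynomial property and nu' = nu'_Phi.  As nu'(Phi_i) does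
   not depend on i, the equality bounds nu(q) from below uniformly in i, so that
   nu(q Phi_i) gets as large as nu(Phi_i) and f is approximated by its remainders.
   "Large" makes sense because every value of nu is bounded by values of nonzero
   constants: a polynomial p of least degree with nu(p) above all constants would
   have degree < d and divide some Phi_i, and then nu'(Phi_i) = nu(Phi_i) by
   multiplicativity.  A key polynomial of degree > d would have a value above all
   nu(Phi_i X^k). *)

From HB Require Import structures.
Require Import Defs.
From mathcomp Require Import all_boot all_order all_algebra.
From mathcomp Require Import boolp classical_sets.

Set Implicit Arguments.
Unset Strict Implicit.
Unset Printing Implicit Defensive.

Import Order.TTheory GRing.Theory Num.Theory.
Local Open Scope classical_set_scope.
Local Open Scope ring_scope.

(** * Arithmetic of an ordered group with infinity adjoined *)

Section WithInf.
Variable G : oagType.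
Implicit Types x y z t : withinf G.

Lemma wi_leD2r z x y : x <= y -> x + z <= y + z.
Proof.
by case: x y z => [a|] [b|] [c|] //= h; apply: (@oag_leD2r G c a b).
Qed.

Lemma wi_leD2l z x y : x <= y -> z + x <= z + y.
Proof. by move=> h; rewrite ![z + _]addrC wi_leD2r. Qed.

Lemma wi_leD x y z t : x <= y -> z <= t -> x + z <= y + t.
Proof. by move=> h1 h2; apply: le_trans (wi_leD2r z h1) (wi_leD2l y h2). Qed.

Lemma wi_addIr z x y : z <> None -> x + z = y + z -> x = y.
Proof. by case: x y z => [a|] [b|] [c|] //= _ [/addIr ->]. Qed.

Lemma wi_ltD2r z x y : z <> None -> x < y -> x + z < y + z.
Proof.
move=> zN; rewrite !lt_neqAle => /andP[neq le]; rewrite wi_leD2r // andbT.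
by apply: contra_neq neq; apply: wi_addIr.
Qed.

Lemma wi_ltD2l z x y : z <> None -> x < y -> z + x < z + y.
Proof. by move=> zN h; rewrite ![z + _]addrC wi_ltD2r. Qed.

Lemma wi_addNone x : x + (None : withinf G) = None.
Proof. by case: x. Qed.

Lemma wi_ltNone x : x <> None -> x < (None : withinf G).
Proof. by case: x. Qed.

Lemma wi_addr_min z x y : z + Order.min x y = Order.min (z + x) (z + y).
Proof.
case: (leP x y) => h; first by apply/esym/min_idPl/wi_leD2l.
by apply/esym/min_idPr/wi_leD2l/ltW.
Qed.

(** An ordered group has no 2-torsion: adding [a] to [a <= 0] or to [0 <= a] gives the reverse
    inequality. It serves to get w(-1) = 0. *)
Lemma wi_double0 x : x + x = 0 -> x = 0.
Proof.
case: x => // a; case=> h; congr Some; apply/eqP; rewrite eq_le.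
case/orP: (oag_le_total a 0) => le; rewrite le ?andbT /=.
  by have := @oag_leD2r G a _ _ le; rewrite h add0r.
by have := @oag_leD2r G a _ _ le; rewrite h add0r => ->.
Qed.

Lemma wi_minxNone x : Order.min x (None : withinf G) = x.
Proof. by apply/min_idPl; case: x. Qed.

Lemma wi_minNonex x : Order.min (None : withinf G) x = x.
Proof. by rewrite minC wi_minxNone. Qed.

End WithInf.

(** Finite minima, with infinity for the empty family, become iterated monoid operations. *)
HB.instance Definition _ (G : oagType) :=
  Monoid.isMonoidLaw.Build (withinf G) None Order.min
    (@wi_minNonex G) (@wi_minxNone G).

(** * Degrees, and valuations read on polynomials *)

Section PolyVal.
Variables (K : fieldType) (G : oagType) (N : nat -> Prop).
Hypothesis N_le : forall m n, (m <= n)%N -> N n -> N m.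
Implicit Types (f g h P : {poly K}) (w : {poly K} -> withinf G) (c : K).

(* N m stands for m < [K[chi] : K] and w f for nu (f(chi)). *)
Definition pm_poly w : Prop :=
  [/\ w 0 = None, forall f, N (deg f) -> w f = None -> f = 0,
      forall f g, Order.min (w f) (w g) <= w (f + g) &
      forall f g, N (deg f + deg g) -> w (f * g) = w f + w g].

Lemma deg_mul f g : f != 0 -> g != 0 -> deg (f * g) = (deg f + deg g)%N.
Proof.
rewrite /deg => f0 g0; rewrite size_mul //; move: f0 g0.
rewrite -!size_poly_gt0; case: (size f) (size g) => [|a] [|b] // _ _.
by rewrite addSn addnS.
Qed.

Lemma degN f : deg (- f) = deg f.
Proof. by rewrite /deg size_polyN. Qed.

Lemma deg_ltE f m : (0 < m)%N -> (deg f < m)%N = (size f <= m)%N.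
Proof. by rewrite /deg; case: (size f). Qed.

Lemma deg_ltB f g m : (deg f < m)%N -> (deg g < m)%N -> (deg (f - g) < m)%N.
Proof.
move=> df; have m0 : (0 < m)%N by apply: leq_ltn_trans df.
move: df; rewrite !deg_ltE // => sf sg.
by apply: leq_trans (size_polyD _ _) _; rewrite size_polyN geq_max sf.
Qed.

Lemma degXn n : deg ('X^n : {poly K}) = n.
Proof. by rewrite /deg size_polyXn. Qed.

Lemma degX : deg ('X : {poly K}) = 1%N.
Proof. by rewrite /deg size_polyX. Qed.

Lemma deg_polyC c : deg c%:P = 0%N.
Proof. by rewrite /deg size_polyC; case: eqP. Qed.

Lemma deg_modp_lt P f : (0 < deg P)%N -> (deg (f %% P) < deg P)%N.
Proof.
move=> dP; have P0 : P != 0.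
  by apply: contraTneq dP => ->; rewrite (deg_polyC 0).
have := ltn_modpN0 f P0; move: dP; rewrite /deg.
by case: (size P) => [|[|n]] //= _; case: (size (f %% P)).
Qed.

Lemma deg_monicB P f : P \is monic -> f \is monic -> (0 < deg P)%N ->
  deg f = deg P -> (deg (f - P) < deg P)%N.
Proof.
move=> mP mf dP e; rewrite deg_ltE //; apply/leq_sizeP => j.
rewrite coefB leq_eqVlt => /orP[/eqP<-|lt].
  rewrite -{1}e (monicP mf : f`_(deg f) = 1) (monicP mP : P`_(deg P) = 1).
  by rewrite subrr.
rewrite !nth_default ?subr0 //; first by move: lt; rewrite /deg; case: (size P).
by move: lt; rewrite -e /deg; case: (size f).
Qed.

Lemma divp_monic P f : P \is monic -> f \is monic -> (0 < deg P)%N ->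
  deg f = deg P -> f %/ P = 1.
Proof.
move=> mP mf dP e; have P0 := monic_neq0 mP.
rewrite -[f](subrK P) divpD divpp // divp_small ?add0r //.
have := deg_monicB mP mf dP e; move: dP; rewrite /deg.
by case: (size P) (size (f - P)) => [|a] [|b].
Qed.

Lemma deg_divp P f : P != 0 -> deg (f %/ P) = (deg f - deg P)%N.
Proof.
by move=> P0; rewrite /deg size_divp // -[LHS]subn1 subnAC subn1.
Qed.

Lemma deg_divp_mul P f : P != 0 -> f %/ P != 0 ->
  (deg (f %/ P) + deg P)%N = deg f.
Proof.
move=> P0 q0; rewrite deg_divp // subnK //; apply: contraNT q0.
rewrite -ltnNge => h; rewrite divp_small //; move: h; rewrite /deg.
by case: (size f) (size P) => [|a] [|b].
Qed.

Lemma size_divp_lt P f : P \is monic -> (0 < deg P)%N -> f != 0 ->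
  (size (f %/ P)%R < size f)%N.
Proof.
move=> mP dP f0; rewrite size_divp ?monic_neq0 //.
move: f0; rewrite -size_poly_gt0 /deg in dP *; case: (size f) => // n _.
by rewrite ltnS leq_subLR -addn1 addnC leq_add.
Qed.

(** * Rules for one pm valuation, and expansions along a monic polynomial *)

Section OneValuation.
Variable w : {poly K} -> withinf G.
Hypothesis pm_w : pm_poly w.

Let w0 : w 0 = None. Proof. by case: pm_w. Qed.
Let wD f g : Order.min (w f) (w g) <= w (f + g).
Proof. by case: pm_w. Qed.

Lemma pmM f g : N (deg f + deg g) -> w (f * g) = w f + w g.
Proof. by case: pm_w => _ _ _; apply. Qed.

Lemma pm_notNone f : N (deg f) -> f != 0 -> w f <> None.
Proof.
by move=> Nf /eqP f0; case: pm_w => _ H _ _ /H; apply: contra_not f0; apply.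
Qed.

Hypothesis N0 : N 0.

Lemma pm1 : w 1 = 0.
Proof.
have wn : w 1 <> None by apply: pm_notNone; rewrite ?oner_neq0 // (deg_polyC 1).
apply: (@wi_addIr _ (w 1)) => //.
by rewrite -pmM ?mulr1 ?add0r // (deg_polyC 1).
Qed.

Lemma pmN1 : w (-1) = 0.
Proof.
have d1 : deg (-1 : {poly K}) = 0%N by rewrite /deg size_polyN size_poly1.
by apply: wi_double0; rewrite -pmM ?d1 // mulrNN mulr1 pm1.
Qed.

Lemma pmCM c c' : w (c * c')%:P = w c%:P + w c'%:P.
Proof. by rewrite polyCM pmM ?deg_polyC. Qed.

(** Plays the role of subtraction in [withinf] for values of constants. *)
Lemma pmC_div b a : a != 0 -> w (b / a)%:P + w a%:P = w b%:P.
Proof. by move=> a0; rewrite -pmCM divfK. Qed.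

Lemma pmC_notNone c : c != 0 -> w c%:P <> None.
Proof. by move=> c0; apply: pm_notNone; rewrite ?deg_polyC // polyC_eq0. Qed.

Lemma pmN f : N (deg f) -> w (- f) = w f.
Proof.
move=> Nf; rewrite -mulN1r pmM ?pmN1 ?add0r //.
by rewrite /deg size_polyN size_poly1.
Qed.

Lemma pmB f g : N (deg g) -> Order.min (w f) (w g) <= w (f - g).
Proof. by move=> Ng; rewrite -(pmN Ng) wD. Qed.

(** If w(f + g) exceeded w(f), then f = (f + g) - g would have value greater than w(f). *)
Lemma pmDl f g : N (deg f) -> N (deg g) -> w f < w g -> w (f + g) = w f.
Proof.
move=> Nf Ng lt; apply/eqP; rewrite eq_le; apply/andP; split.
  have := pmB (f + g) Ng; rewrite addrK ge_min => /orP[//|].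
  by rewrite leNgt lt.
by have := wD f g; rewrite (min_idPl (ltW lt)).
Qed.

Lemma pmDr f g : N (deg f) -> N (deg g) -> w g < w f -> w (f + g) = w g.
Proof. by move=> Nf Ng lt; rewrite addrC pmDl. Qed.

Lemma pmBl f g : N (deg f) -> N (deg g) -> w f < w g -> w (f - g) = w f.
Proof. by move=> Nf Ng lt; rewrite pmDl ?degN ?pmN. Qed.

Lemma pmBr f g : N (deg f) -> N (deg g) -> w g < w f -> w (f - g) = w g.
Proof. by move=> Nf Ng lt; rewrite pmDr ?degN ?pmN. Qed.

Lemma pm_divp_ge P f x : x <= w (f %% P) -> x <= w (f %/ P * P) -> x <= w f.
Proof.
move=> h1 h2; rewrite [f in leRHS](divp_eq f P).
by apply: le_trans (wD _ _); rewrite le_min h1 h2.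
Qed.

Lemma pmM_divp P f : N (deg P) -> P != 0 -> N (deg f) ->
  w (f %/ P * P) = w (f %/ P) + w P.
Proof.
move=> NP P0 Nf; have [->|q0] := eqVneq (f %/ P) 0.
  by rewrite mul0r w0.
by rewrite pmM // deg_divp_mul.
Qed.

(** Horner induction: multiplication by X shifts the bound by [w c0%:P], and adding a constant
    lowers it at most to the value of that constant. *)
Lemma pm_ge_const c0 : c0 != 0 -> w c0%:P <= w 'X ->
  forall f, N (deg f) -> exists2 c, c != 0 & w c%:P <= w f.
Proof.
move=> c00 le0; elim/poly_ind => [|q c IHq] Nf.
  by exists 1; rewrite ?oner_neq0 // w0; apply: lex1.
have NqX : q != 0 -> N (deg q + deg ('X : {poly K})).
  move=> q0; apply: N_le Nf; rewrite -deg_mul ?polyX_eq0 // /deg.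
  rewrite size_polyDl // size_mulX // ltnS (leq_trans (size_polyC_leq1 _)) //.
  by rewrite size_poly_gt0.
have [c1 c10 le1] : exists2 c1, c1 != 0 & w c1%:P <= w (q * 'X).
  have [->|q0] := eqVneq q 0.
    by exists 1; rewrite ?oner_neq0 // mul0r w0; apply: lex1.
  have [|c1 c10 le1] := IHq; first exact: N_le (leq_addr _ _) (NqX q0).
  exists (c1 * c0); first exact: mulf_neq0.
  by rewrite pmCM (pmM (NqX q0)) wi_leD.
have [->|cn0] := eqVneq c 0; first by exists c1; rewrite ?addr0.
have := wD (q * 'X) c%:P; rewrite ge_min => /orP[] le.
  by exists c1 => //; apply: le_trans le.
by exists c.
Qed.

(** The form of [nu_sub] on polynomials; for [w f = nu (evchi iota chi f)] the two are
    convertible. *)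
Definition poly_sub P f : withinf G :=
  \big[Order.min/None]_(i < size f) (w (digit P f i) + w P *+ i).

Lemma poly_sub_widen P f m : P \is monic -> (0 < deg P)%N -> (size f <= m)%N ->
  poly_sub P f = \big[Order.min/None]_(i < m) (w (digit P f i) + w P *+ i).
Proof.
move=> mP dP /subnKC <-; elim: (m - _)%N => [|k IHk]; first by rewrite addn0.
rewrite addnS big_ord_recr /= -IHk /digit [f %/ _]divp_small.
  by rewrite mod0p w0 wi_minxNone.
have P0 : (0 < size (P ^+ (size f + k))%R)%N.
  by rewrite size_poly_gt0 expf_neq0 // monic_neq0.
rewrite -(prednK P0) ltnS size_exp (leq_trans (leq_addr k _)) //.
exact: leq_pmull.
Qed.

(** The digits of [f] of positive index are those of [f %/ P], shifted by one. *)
Lemma poly_sub_rec P f : P \is monic -> (0 < deg P)%N ->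
  poly_sub P f = Order.min (w (f %% P)) (w P + poly_sub P (f %/ P)).
Proof.
move=> mP dP.
(* Digits past the size are zero; one extra index for [f] makes the ranges agree once digit 0 is
   split off. *)
rewrite (poly_sub_widen mP dP (leqnSn _)) (poly_sub_widen mP dP (leq_divp f P)).
rewrite big_ord_recl /=; congr (Order.min _ _).
  by rewrite /digit expr0 divp1 mulr0n addr0.
rewrite (big_morph _ (@wi_addr_min G (w P)) (wi_addNone _)).
apply: eq_bigr => i _; rewrite /digit /bump add1n exprS divp_divl mulrS.
by rewrite addrCA.
Qed.

End OneValuation.

(** * Two valuations that agree in degree less than [d] and differ in degree [d] *)

Section TwoValuations.
Variables (w w' : {poly K} -> withinf G) (d : nat).
Hypotheses (pm_w : pm_poly w) (pm_w' : pm_poly w').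
Hypotheses (d_gt0 : (0 < d)%N) (Nd : N d).
Hypothesis w'_le : forall f, w' f <= w f.
Hypothesis w'_eq : forall f, (deg f < d)%N -> w' f = w f.

Let N0 : N 0. Proof. exact: N_le (leq0n d) Nd. Qed.

Section Augment.
Variable P : {poly K}.
Hypotheses (mP : P \is monic) (degP : deg P = d) (w'P : w' P < w P).

Let P0 : P != 0. Proof. exact: monic_neq0. Qed.
Let dP : (0 < deg P)%N. Proof. by rewrite degP. Qed.
Let NP : N (deg P). Proof. by rewrite degP. Qed.
Let w00 : w 0 = None. Proof. by case: pm_w. Qed.
Let w'00 : w' 0 = None. Proof. by case: pm_w'. Qed.

Lemma N_divp f : N (deg f) -> N (deg (f %/ P)).
Proof. by apply: N_le; rewrite deg_divp // leq_subr. Qed.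

Lemma N_divpM f : N (deg f) -> N (deg (f %/ P * P)).
Proof.
have [->|q0] := eqVneq (f %/ P) 0; first by rewrite mul0r (deg_polyC 0).
by rewrite deg_mul // deg_divp_mul.
Qed.

Lemma w_modp f : w' (f %% P) = w (f %% P).
Proof. by rewrite w'_eq // -degP deg_modp_lt. Qed.

Lemma N_modp f : N (deg (f %% P)).
Proof. by apply: N_le NP; apply/ltnW/deg_modp_lt. Qed.

(** By multiplicativity the gap at [P] passes to the multiple, because [w (f %/ P)] is finite. *)
Lemma w'_divpM_lt f : N (deg f) -> f %/ P != 0 ->
  w' (f %/ P * P) < w (f %/ P * P).
Proof.
move=> Nf q0; rewrite (pmM_divp pm_w) // (pmM_divp pm_w') //.
apply: le_lt_trans (wi_leD2r _ (w'_le _)) _.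
by apply: wi_ltD2l w'P; apply: (pm_notNone pm_w) => //; apply: N_divp.
Qed.

(* A cancellation between the two terms under [w'] would force [w] and [w'] to
   agree on the second one. *)
Lemma w'_divp f : N (deg f) ->
  w' f = Order.min (w' (f %% P)) (w' P + w' (f %/ P)).
Proof.
move=> Nf; rewrite [w' P + _]addrC -(pmM_divp pm_w') //.
have fE := divp_eq f P; rewrite {1}fE.
case: (ltgtP (w' (f %% P)) (w' (f %/ P * P))) => [lt|lt|e].
- by rewrite (pmDr pm_w' N0 (N_divpM Nf) (N_modp f)).
- by rewrite (pmDl pm_w' N0 (N_divpM Nf) (N_modp f)).
rewrite -fE; apply/eqP; rewrite eq_le.
have -> : w' (f %% P) <= w' f.
  by apply: (@pm_divp_ge _ pm_w' P); rewrite ?e.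
rewrite andbT leNgt; apply/negP => lt.
have q0 : f %/ P != 0.
  apply: contraTneq lt => q0; move: e; rewrite q0 mul0r w'00 => ->.
  by rewrite -leNgt lex1.
have := w'_divpM_lt Nf q0; rewrite -e.
have {}lt : w (f %% P) < w f by rewrite -w_modp; apply: lt_le_trans (w'_le f).
have -> : f %/ P * P = f - f %% P by rewrite {2}fE addrK.
by rewrite (pmBr pm_w N0 Nf (N_modp f) lt) w_modp ltxx.
Qed.

(** By [w'_divp] and [poly_sub_rec], both sides satisfy the same recursion. *)
Lemma w'_poly_sub f : N (deg f) -> w' f = poly_sub w' P f.
Proof.
have [n] := ubnP (size f); elim: n f => // n IHn f ltn Nf.
have [->|f0] := eqVneq f 0.
  by rewrite /poly_sub size_poly0 big_ord0 w'00.
rewrite (poly_sub_rec pm_w') // w'_divp // -IHn ?N_divp //.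
by apply: leq_trans (size_divp_lt mP dP f0) _.
exact: N_divp.
Qed.

(** Let q be the quotient of fg by P. If q is nonzero, w(fg) = w'(fg) <= w'(qP) < w(qP), because [w]
    and [w'] agree on both factors; the remainder fg - qP then has the value of fg. *)
Lemma w_key f g : f != 0 -> g != 0 -> (deg f < d)%N -> (deg g < d)%N ->
  N (deg f + deg g) ->
  [/\ w (f * g) = w ((f * g) %% P), w' (f * g) = w' ((f * g) %% P) &
      w ((f * g) %% P) < w ((f * g) %/ P * P)].
Proof.
move=> f0 g0 df dg Nfg; have fg0 : f * g != 0 by rewrite mulf_neq0.
have Nfg' : N (deg (f * g)) by rewrite deg_mul.
have e : w' (f * g) = w (f * g).
  by rewrite (pmM pm_w) // (pmM pm_w') // !w'_eq.
suff lt : w (f * g) < w ((f * g) %/ P * P).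
  have e' : w (f * g) = w ((f * g) %% P).
    have -> : (f * g) %% P = f * g - (f * g) %/ P * P.
      by rewrite {2}(divp_eq (f * g) P) addrC addKr.
    by rewrite (pmBl pm_w N0 Nfg' (N_divpM Nfg') lt).
  by split; rewrite ?w_modp ?e // -e'.
have [q0|q0] := eqVneq ((f * g) %/ P) 0.
  by rewrite q0 mul0r w00; apply/wi_ltNone/(pm_notNone pm_w).
apply: le_lt_trans (w'_divpM_lt Nfg' q0).
by rewrite -e w'_divp // (pmM_divp pm_w') // ge_min [w' P + _]addrC lexx orbT.
Qed.

End Augment.

(** * The sequence [Phi_]: bounds by constants and their consequences *)

Section Sequence.
Variables (Phi : {poly K}) (Phi_ : nat -> {poly K}).
Hypothesis d_ge2 : (2 <= d)%N.
Hypotheses (mPhi : Phi \is monic) (degPhi : deg Phi = d).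
Hypothesis w'Phi : w' Phi < w Phi.
Hypothesis mPhi_ : forall i, Phi_ i \is monic.
Hypothesis degPhi_ : forall i, deg (Phi_ i) = d.
Hypothesis Phi_incr : forall i j, (i < j)%N -> w (Phi_ i) < w (Phi_ j).
Hypothesis Phi_cofinal : forall f, w f <> None -> exists i, w f <= w (Phi_ i).
Hypothesis Phi_gt : forall i, w Phi < w (Phi_ i).
(** What the limit assumption on chi^d becomes for polynomials. *)
Hypothesis Phi_limit : forall P, P \is monic -> deg P = d ->
  exists2 s, (deg s < d)%N & w s = w P.

Lemma w'_Phi_ i : w' (Phi_ i) = w' Phi.
Proof.
have NPhi : N (deg Phi) by rewrite degPhi.
have dh : (deg (Phi_ i - Phi) < d)%N.
  by rewrite -degPhi deg_monicB ?degPhi ?degPhi_.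
have Nh : N (deg (Phi_ i - Phi)) by apply: N_le Nd; apply: ltnW.
rewrite -[Phi_ i](subrK Phi) (pmDr pm_w' N0) // (w'_eq dh).
by rewrite (pmBr pm_w N0) ?degPhi_.
Qed.

Lemma w'_Phi_lt i : w' (Phi_ i) < w (Phi_ i).
Proof. by rewrite w'_Phi_; apply: lt_trans w'Phi (Phi_gt i). Qed.

(* If w 'X were below all constants, the leading monomial would determine w f
   for monic f of degree at most d, and w (Phi_ 0) = w (Phi_ 1). *)
Lemma pm_X_ge_const : exists2 c, c != 0 & w c%:P <= w 'X.
Proof.
apply: contrapT => H.
have Xlt c : c != 0 -> w 'X < w c%:P.
  by move=> c0; rewrite ltNge; apply/negP => le; apply: H; exists c.
have X_le1 : w 'X <= w 1 by apply/ltW/(Xlt 1); rewrite oner_neq0.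
(* The bound by [w 1] strengthens the induction: it gives w(qX) <= w(X) < w(c), so the constant term
   c does not affect the value. *)
have key f : f \is monic -> (deg f <= d)%N ->
    w f = w 'X^(deg f) /\ w 'X^(deg f) <= w 1.
  elim/poly_ind: f => [|q c IHq].
    by rewrite monicE lead_coef0 eq_sym oner_eq0.
  have [->|q0] := eqVneq q 0.
    rewrite mul0r add0r monicE lead_coefC => /eqP-> _.
    by rewrite (deg_polyC 1) expr0.
  have ltc : (size c%:P < size (q * 'X)%R)%N.
    rewrite size_mulX // ltnS (leq_trans (size_polyC_leq1 _)) //.
    by rewrite size_poly_gt0.
  have degE : deg (q * 'X + c%:P) = (deg q).+1.
    rewrite /deg size_polyDl // size_mulX //= prednK //.
    by rewrite size_poly_gt0.
  rewrite monicE lead_coefDl // lead_coefMX -monicE degE => mq dq.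
  have [||wq le1] := IHq => //; first exact: ltnW.
  have Nq : N (deg q + deg ('X : {poly K})).
    by apply: N_le Nd; rewrite degX addn1.
  have wqX : w (q * 'X) = w 'X^((deg q).+1).
    by rewrite exprSr (pmM pm_w) // wq (pmM pm_w) // degXn.
  have wX1 : w (q * 'X) <= w 'X.
    rewrite (pmM pm_w) // wq -[leRHS]add0r; apply: wi_leD2r.
    by rewrite -(pm1 pm_w N0).
  split; last by rewrite -wqX; apply: le_trans X_le1.
  have [->|c0] := eqVneq c 0; first by rewrite addr0.
  rewrite (pmDl pm_w N0) //.
  - by rewrite deg_mul // polyX_eq0.
  - by rewrite deg_polyC.
  - by apply: le_lt_trans wX1 (Xlt c c0).
have := Phi_incr (ltn0Sn 0).
have [|-> _] := key _ (mPhi_ 0); first by rewrite degPhi_.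
have [|-> _] := key _ (mPhi_ 1); first by rewrite degPhi_.
by rewrite !degPhi_ ltxx.
Qed.

Lemma w'C c : w' c%:P = w c%:P.
Proof. by rewrite w'_eq // deg_polyC. Qed.

(** Here [d >= 2] enters: X has degree less than [d], so the lower bound for [w 'X] is also one for
    [w' 'X]. *)
Lemma w'_ge_const f : N (deg f) -> exists2 c, c != 0 & w c%:P <= w' f.
Proof.
have [c0 c00 le0] := pm_X_ge_const => Nf.
have [|c cn0 le] := pm_ge_const pm_w' N0 c00 _ Nf.
  by rewrite w'C w'_eq // degX.
by exists c; rewrite // -w'C.
Qed.

Lemma w_ge_const f : N (deg f) -> exists2 c, c != 0 & w c%:P <= w f.
Proof.
by case/w'_ge_const => c c0 le; exists c => //; apply: le_trans (w'_le f).
Qed.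

(** Strong induction on the degree. Above [d], cofinality leads back to some [Phi_ i]; in degree
    [d], the limit hypothesis leads back to a polynomial of lower degree. *)
Lemma w_le_const f : N (deg f) -> f != 0 -> exists2 c, c != 0 & w f <= w c%:P.
Proof.
have [n] := ubnP (deg f); elim: n f => // n IHn f ltn Nf f0.
have [deg0|deg_gt0] := posnP (deg f).
  have fE : f = (f`_0)%:P.
    by apply: size1_polyC; move: deg0; rewrite /deg; case: (size f) => [|[]].
  by exists f`_0; [rewrite -polyC_eq0 -fE | rewrite -fE].
case: (ltngtP (deg f) d) => [ltd|gtd|eqd].
(* An [f] of degree less than [d] above all constants is divided into some Phi_i with w(f) <=
   w(Phi_i). *)
- apply: contrapT => H.
  have big c : c != 0 -> w c%:P < w f.
    by move=> c0; rewrite ltNge; apply/negP => le; apply: H; exists c.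
  have [i lei] := Phi_cofinal (pm_notNone pm_w Nf f0).
  have PE := divp_eq (Phi_ i) f.
  set q := Phi_ i %/ f in PE; set r := Phi_ i %% f in PE.
  have q0 : q != 0.
    apply: contraTneq ltd => q0; rewrite -leqNgt -(degPhi_ i) PE q0 mul0r add0r.
    exact/ltnW/deg_modp_lt.
  have degq : (deg q + deg f)%N = d by rewrite deg_divp_mul.
  have ltq : (deg q < d)%N by rewrite -degq -[ltnLHS]addn0 ltn_add2l.
  have wqf : w (q * f) = w q + w f by rewrite (pmM pm_w) // degq.
  (* If r = 0, Phi_i is a product of two factors of degree less than [d], on which [w] and [w']
     agree, against [w'_Phi_lt]. *)
  have [r0|r0] := eqVneq r 0.
    move: PE (w'_Phi_lt i); rewrite r0 addr0 => ->.
    by rewrite wqf (pmM pm_w') ?degq // !w'_eq // ltxx.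
  have ltr : (deg r < deg f)%N by apply: deg_modp_lt.
  have [||b b0 leb] := IHn r _ _ r0.
  - exact: leq_trans ltr _.
  - by apply: N_le Nf; apply: ltnW.
  have [|a a0 lea] := @w_ge_const q.
    by apply: N_le Nd; apply: ltnW.
  (* As w(a) <= w(q) and w(f) > w(b / a), the value of q f exceeds w(b) >= w(r). Hence w(Phi_i) =
     w(r) < w(f), a contradiction. *)
  have ltb : w b%:P < w (q * f).
    rewrite wqf -(pmC_div pm_w N0 b a0) [w q + _]addrC.
    apply: lt_le_trans (wi_leD2l _ lea).
    apply: wi_ltD2r; first exact: pmC_notNone.
    by apply: big; rewrite mulf_neq0 ?invr_eq0.
  have := lt_le_trans (le_lt_trans leb (big b b0)) lei.
  rewrite PE (pmDr pm_w N0) ?ltxx //.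
  - by rewrite deg_mul // degq.
  - by apply: N_le Nf; apply: ltnW.
  - exact: le_lt_trans ltb.
- have [i lei] := Phi_cofinal (pm_notNone pm_w Nf f0).
  have [|||b b0 leb] := IHn (Phi_ i).
  - by rewrite degPhi_; apply: leq_trans gtd _.
  - by rewrite degPhi_.
  - exact: monic_neq0.
  by exists b => //; apply: le_trans leb.
(* The limit hypothesis concerns monic polynomials, so the leading coefficient is split off. *)
- have l0 : lead_coef f != 0 by rewrite lead_coef_eq0.
  set g := (lead_coef f)^-1 *: f.
  have mg : g \is monic by rewrite monicE lead_coefZ mulVf.
  have degg : deg g = d by rewrite /deg size_scale ?invr_eq0.
  have fE : f = (lead_coef f)%:P * g.
    by rewrite mul_polyC scalerA divff // scale1r.
  have Ng : N (deg g) by rewrite degg.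
  have [s ds es] := Phi_limit mg degg.
  have s0 : s != 0.
    apply/negP => /eqP s0; have := pm_notNone pm_w Ng (monic_neq0 mg).
    by rewrite -es s0; case: pm_w.
  have [||b b0 leb] := IHn s _ _ s0.
  - by apply: leq_trans ds _; rewrite -eqd.
  - by apply: N_le Nd; apply: ltnW.
  exists (lead_coef f * b); first exact: mulf_neq0.
  rewrite {1}fE (pmM pm_w) ?deg_polyC // (pmCM pm_w N0) -es.
  exact: wi_leD2l.
Qed.

Lemma w_Phi_ge c : c != 0 ->
  exists n, forall i, (n <= i)%N -> w c%:P < w (Phi_ i).
Proof.
move=> c0; have [n le] := Phi_cofinal (pmC_notNone pm_w N0 c0).
by exists n.+1 => i lti; apply: le_lt_trans le (Phi_incr lti).
Qed.

(** By [w'_divp], w'(f) <= w'(Phi_i) + w'(f %/ Phi_i), where w'(Phi_i) = w'(Phi) for all i. So the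
    quotients are bounded below uniformly in i, while w(Phi_i) grows. *)
Lemma quotient_large f c : N (deg f) -> c != 0 ->
  exists n, forall i, (n <= i)%N -> w c%:P < w (Phi_ i) + w' (f %/ Phi_ i).
Proof.
move=> Nf c0; have [a a0 lea] := w'_ge_const Nf.
have [||b b0 leb] := @w_le_const Phi; rewrite ?degPhi ?monic_neq0 //.
(* From w(a) <= w'(f) and w'(Phi) < w(Phi) <= w(b), the quotient has w'-value at least w(a / b);
   hence this constant. *)
have [|n Hn] := @w_Phi_ge (c * b / a).
  by rewrite !mulf_neq0 ?invr_eq0.
exists n => i /Hn lt; rewrite ltNge; apply/negP => le.
have := wi_ltD2r (pmC_notNone pm_w N0 a0) lt.
rewrite (pmC_div pm_w N0) // (pmCM pm_w N0) ltNge => /negP; apply.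
apply: le_trans (wi_leD2r _ le); rewrite -addrA; apply: wi_leD2l.
apply: le_trans lea _; rewrite (w'_divp (mPhi_ i) (degPhi_ i) (w'_Phi_lt i) Nf).
rewrite ge_min; apply/orP; right; rewrite w'_Phi_ [leRHS]addrC.
by apply: wi_leD2r; apply: le_trans (ltW w'Phi) leb.
Qed.

Lemma quotient_le i f : N (deg f) ->
  w (Phi_ i) + w' (f %/ Phi_ i) <= w (f %/ Phi_ i * Phi_ i).
Proof.
move=> Nf; rewrite (pmM_divp pm_w) ?degPhi_ ?monic_neq0 // addrC.
exact: wi_leD2r.
Qed.

Lemma poly_sub_mono P f : poly_sub w' P f <= poly_sub w P f.
Proof.
have muln_mono i : w' P *+ i <= w P *+ i.
  by elim: i => // i IHi; rewrite !mulrS wi_leD.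
apply: (big_ind2 (fun x y : withinf G => x <= y)) => //
  [x1 x2 y1 y2 le1 le2|i _].
  by rewrite le_min !ge_min le1 le2 orbT.
exact: wi_leD.
Qed.

(** For large i the term (f %/ Phi_i) Phi_i has value greater than w(f), so the remainder has the
    value of [f]. *)
Lemma eventually_modp f : N (deg f) -> exists n, forall i, (n <= i)%N ->
  w (f %% Phi_ i) = w f /\ poly_sub w (Phi_ i) f = w f.
Proof.
move=> Nf; have [->|f0] := eqVneq f 0.
  exists 0%N => i _; rewrite mod0p /poly_sub size_poly0 big_ord0.
  by split=> //; case: pm_w.
have [c c0 lec] := w_le_const Nf f0; have [n Hn] := quotient_large Nf c0.
exists n => i /Hn lt; have {}lt := le_lt_trans lec lt.
have dP : (0 < deg (Phi_ i))%N by rewrite degPhi_.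
have wr : w (f %% Phi_ i) = w f.
  have -> : f %% Phi_ i = f - f %/ Phi_ i * Phi_ i.
    by rewrite {2}(divp_eq f (Phi_ i)) addrC addKr.
  rewrite (pmBl pm_w N0) //; first exact: (N_divpM (mPhi_ i)).
  exact: lt_le_trans lt (quotient_le i Nf).
split=> //; rewrite (poly_sub_rec pm_w) // wr; apply/min_idPl.
(* The bound is on w' of the quotient, which equals its [poly_sub w'] and is therefore at most its
   [poly_sub w]. *)
apply: le_trans (ltW lt) (wi_leD2l _ _).
rewrite (w'_poly_sub (mPhi_ i) (degPhi_ i) (w'_Phi_lt i)).
  exact: poly_sub_mono.
exact: (N_divp (mPhi_ i)).
Qed.

(** This and [value_approx] give the two inclusions in the proof of density. *)
Lemma value_attained f : N (deg f) -> exists2 s, (deg s < d)%N & w s = w f.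
Proof.
move=> Nf; have [n /(_ n (leqnn n)) [e _]] := eventually_modp Nf.
by exists (f %% Phi_ n); rewrite // -(degPhi_ n) deg_modp_lt // degPhi_.
Qed.

Lemma value_approx f s : N (deg f) -> (deg s < d)%N -> s != 0 ->
  exists2 t, (deg t < d)%N & w (f - t) = w s.
Proof.
move=> Nf ds s0; have Ns : N (deg s) by apply: N_le Nd; apply: ltnW.
have [c c0 lec] := w_le_const Ns s0.
have [n /(_ n (leqnn n)) lt] := quotient_large Nf c0.
have dP : (0 < deg (Phi_ n))%N by rewrite degPhi_.
(* Subtracting this from [f] leaves (f %/ Phi_n) Phi_n + s, whose first term has value greater than
   w(s). *)
exists (f %% Phi_ n - s).
  by apply: deg_ltB => //; rewrite -(degPhi_ n) deg_modp_lt.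
have -> : f - (f %% Phi_ n - s) = f %/ Phi_ n * Phi_ n + s.
  by rewrite {1}(divp_eq f (Phi_ n)) opprB -addrA [_ %% _ + _]addrC subrK.
rewrite (pmDr pm_w N0) //; first exact: (N_divpM (mPhi_ n)).
exact: le_lt_trans lec (lt_le_trans lt (quotient_le n Nf)).
Qed.

(** The witnesses are some Phi_n and X^(deg P - d). Their product is monic of degree deg P, so its
    quotient by P is 1, and n is taken so large that the product has value at least w(P). *)
Lemma no_larger_key P : P \is monic -> (d < deg P)%N -> N (deg P) ->
  exists f g, [/\ f != 0, g != 0, (deg f < deg P)%N, (deg g < deg P)%N &
    (deg f + deg g)%N = deg P /\ w ((f * g) %/ P * P) <= w (f * g)].
Proof.
move=> mP ltd NP; set X := 'X^(deg P - d) : {poly K}.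
have dX : deg X = (deg P - d)%N by exact: degXn.
have NX : N (deg X) by apply: N_le NP; rewrite dX leq_subr.
have mX : X \is monic by rewrite monicXn.
have [a a0 lea] := w_ge_const NX.
have [b b0 leb] := w_le_const NP (monic_neq0 mP).
(* As w(a) bounds the power of X from below and w(b) bounds w(P) from above, a Phi_n above b / a
   suffices. *)
have [|n /(_ n (leqnn n)) lt] := @w_Phi_ge (b / a).
  by rewrite mulf_neq0 ?invr_eq0.
have degE : (deg (Phi_ n) + deg X)%N = deg P.
  by rewrite dX degPhi_ subnKC // ltnW.
exists (Phi_ n), X; split; rewrite ?monic_neq0 ?degPhi_ //.
  by rewrite dX -subn_gt0 subKn ?(ltn_trans _ ltd) // ltnW.
split; first by rewrite -(degPhi_ n).
rewrite divp_monic ?mul1r //; last by rewrite deg_mul ?monic_neq0.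
- rewrite (pmM pm_w) ?degE //; apply: le_trans leb _.
  by rewrite -(pmC_div pm_w N0 b a0) wi_leD // ltW.
- by rewrite monicMr.
- exact: leq_trans ltd.
Qed.

End Sequence.

End TwoValuations.

End PolyVal.

(** * Evaluation at chi: passage between polynomials and K[chi] *)

Section Evaluation.
Variables (K L : fieldType) (iota : {rmorphism K -> L}) (chi : L).
Implicit Types (f g : {poly K}) (m n : nat).

Local Notation ev := (evchi iota chi).
Local Notation N := (lt_extdeg iota chi).

Lemma evD f g : ev (f + g) = ev f + ev g.
Proof. by rewrite /evchi rmorphD hornerD. Qed.

Lemma evM f g : ev (f * g) = ev f * ev g.
Proof. by rewrite /evchi rmorphM hornerM. Qed.

Lemma evN f : ev (- f) = - ev f.
Proof. by rewrite /evchi rmorphN hornerN. Qed.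

Lemma ev0 : ev 0 = 0.
Proof. by rewrite /evchi rmorph0 horner0. Qed.

Lemma evC c : ev c%:P = iota c.
Proof. by rewrite /evchi map_polyC hornerC. Qed.

Lemma evXn n : ev 'X^n = chi ^+ n.
Proof. by rewrite /evchi map_polyXn hornerXn. Qed.

Lemma ev_sum m (F : 'I_m -> {poly K}) : ev (\sum_i F i) = \sum_i ev (F i).
Proof. exact: (big_morph _ evD ev0). Qed.

Lemma ev_Kchi f : Kchi iota chi (ev f).
Proof. by exists f. Qed.

Lemma ev_modp f g : ev g = 0 -> ev (f %% g) = ev f.
Proof. by move=> g0; rewrite {2}(divp_eq f g) evD evM g0 mulr0 add0r. Qed.

(** If a nonzero f of degree at most m vanishes at chi, remainders modulo f represent any m + 1
    elements of K[chi] by vectors of length m, so they are dependent. Conversely, injectivity makes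
    1, chi, ..., chi^m independent. *)
Lemma lt_extdegP m :
  N m <-> forall f, (deg f <= m)%N -> ev f = 0 -> f = 0.
Proof.
split=> [[b bK bfree] f df f0|inj].
  apply: contrapT => /eqP fn0.
  have [h hE] : {h : 'I_m.+1 -> {poly K} & forall i, ev (h i) = b i}.
    apply: (@choice _ _ (fun i g => ev g = b i)) => i.
    by have [f' _ <-] := bK i; exists f'.
  pose A := \matrix_(i < m.+1, j < m) (h i %% f)`_j.
  have size_r i : (size (h i %% f)%R <= m)%N.
    apply: leq_trans df; have := ltn_modpN0 (h i) fn0.
    by rewrite /deg; case: (size f).
  (* [A] has m + 1 rows and m columns; a nonzero [u] in its left kernel is a linear relation between
     the remainders, hence between the [b i]. *)
  have /rowV0Pn[u /sub_kermxP uA un0] : kermx A != 0.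
    by rewrite kermx_eq0 /row_free neq_ltn ltnS rank_leq_col.
  have r0 : \sum_i (u 0 i)%:P * (h i %% f) = 0.
    apply/polyP => j; rewrite coef0 coef_sum.
    have [ltj|lej] := ltnP j m.
      have := congr1 (fun M : 'rV_m => M 0 (Ordinal ltj)) uA.
      rewrite !mxE => uAj; rewrite -[RHS]uAj; apply: eq_bigr => i _.
      by rewrite coefCM [A _ _]mxE.
    apply: big1 => i _; rewrite coefCM nth_default ?mulr0 //.
    exact: leq_trans lej.
  case/eqP: un0; apply/rowP => i; rewrite mxE; apply: bfree.
  have := congr1 ev r0; rewrite ev_sum ev0 => evr.
  rewrite -[RHS]evr; apply: eq_bigr => j _.
  by rewrite evM evC ev_modp // hE.
exists (fun i => ev 'X^i) => [i|c c0 i]; first exact: ev_Kchi.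
have : \sum_(i < m.+1) (c i)%:P * 'X^i = 0.
  apply: inj; last first.
    by rewrite ev_sum -[RHS]c0; apply: eq_bigr => j _; rewrite evM evC.
  rewrite -ltnS deg_ltE //; apply: (leq_trans (size_sum _ _ _)).
  apply/bigmax_leqP => j _; rewrite mul_polyC.
  by apply: leq_trans (size_scale_leq _ _) _; rewrite size_polyXn.
move/(congr1 (fun p : {poly K} => p`_i)); rewrite coef0 coef_sum => <-.
rewrite (bigD1 i) //= coefCM coefXn eqxx mulr1 big1 ?addr0 // => j ji.
by rewrite coefCM coefXn eq_sym (negPf (ji : (j : nat) != i)) mulr0.
Qed.

Lemma lt_extdeg_le m n : (m <= n)%N -> N n -> N m.
Proof.
move=> le /lt_extdegP inj; apply/lt_extdegP => f df.
by apply: inj; apply: leq_trans le.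
Qed.

Lemma lt_extdeg0 : N 0.
Proof.
apply/lt_extdegP => f; rewrite -ltnS deg_ltE // => /size1_polyC ->.
by rewrite evC => /eqP; rewrite fmorph_eq0 => /eqP ->.
Qed.

(** If deg f is too large, some nonzero h of degree at most deg f vanishes at chi, and [f %% h] is a
    smaller representative. *)
Lemma Kchi_repr y : Kchi iota chi y -> exists2 f, N (deg f) & ev f = y.
Proof.
case=> f _ <-{y}; have [n] := ubnP (size f); elim: n f => // n IHn f ltn.
have [Nf|nNf] := pselect (N (deg f)); first by exists f.
have f_gt0 : (0 < size f)%N.
  rewrite size_poly_gt0; apply/eqP => f0; apply: nNf.
  by rewrite f0 (deg_polyC 0); apply: lt_extdeg0.
have [h [dh [h0 hn0]]] : exists h, (deg h <= deg f)%N /\ ev h = 0 /\ h <> 0.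
  apply: contrapT => H; apply: nNf; apply/lt_extdegP => h dh h0.
  by apply: contrapT => hn0; apply: H; exists h.
have [|g Ng gE] := IHn (f %% h); last by exists g; rewrite // gE ev_modp.
apply: leq_trans (ltn_modpN0 f (introN eqP hn0)) _; rewrite -ltnS.
apply: leq_trans ltn; move: dh f_gt0; rewrite /deg ltnS.
by case: (size h) (size f) => [|a] [|b].
Qed.

Lemma pm_poly_of (G : oagType) (nu : L -> withinf G) :
  pm_valuation iota chi nu -> pm_poly N (fun f => nu (ev f)).
Proof.
case=> -[nuN nuD _] nuM _; split=> [|f Nf|f g|f g]; last exact: nuM.
- by rewrite ev0; apply/(nuN 0) => //; exists 0; rewrite ?ev0.
- by move/(nuN _ (ev_Kchi f)); apply: (iffLR (lt_extdegP _) Nf).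
- by rewrite evD; apply: nuD; apply: ev_Kchi.
Qed.

Lemma Kchi_le_ev f m : (0 < m)%N -> (deg f < m)%N ->
  Kchi_le iota chi m.-1 (ev f).
Proof. by move=> m0 df; exists f; rewrite //= -ltnS prednK. Qed.

Lemma Kchi_le_submodule m : Ksubmodule iota (Kchi_le iota chi m).
Proof.
split=> [|_ _ [f /= df <-] [g /= dg <-]|x _ [f /= df <-]].
- by exists 0; rewrite ?ev0 //= (deg_polyC 0).
- exists (f + g); rewrite ?evD //= -ltnS -[g]opprK.
  by apply: deg_ltB; rewrite ?degN ltnS.
- exists (x%:P * f); rewrite ?evM ?evC //=.
  rewrite -ltnS deg_ltE // mul_polyC; apply: leq_trans (size_scale_leq _ _) _.
  by rewrite -deg_ltE // ltnS.
Qed.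

Lemma Kchi_le_sub m : Kchi_le iota chi m `<=` Kchi iota chi.
Proof. by move=> _ [f _ <-]; apply: ev_Kchi. Qed.

End Evaluation.

(** * Transfer of the polynomial results to K[chi] *)

Theorem proposition4p8 (K L : fieldType) (iota : {rmorphism K -> L}) (chi : L)
    (G : oagType) (nu nu' : L -> withinf G) (d : nat)
    (Phi : {poly K}) (Phi_ : nat -> {poly K})
    (chi_notin_K : forall x : K, iota x <> chi)
    (d_ge2 : (2 <= d)%N) (d_lt : lt_extdeg iota chi d)
    (pm_nu : pm_valuation iota chi nu) (pm_nu' : pm_valuation iota chi nu')
    (rank_nu : finite_rank (values nu (range iota)))
    (no_greatest : forall M : set L, Ksubmodule iota M ->
       M `<=` Kchi iota chi -> ~ has_greatest (values nu M))
    (nu'_le : forall y, Kchi iota chi y -> nu' y <= nu y)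
    (chid_limit : limit_over nu (Kchi_le iota chi d.-1) (chi ^+ d))
    (nu'_eq : forall y, Kchi_le iota chi d.-1 y -> nu' y = nu y)
    (Phi_monic : Phi \is monic) (Phi_deg : deg Phi = d)
    (nu'_Phi : nu' (evchi iota chi Phi) < nu (evchi iota chi Phi))
    (Phi_i_monic : forall i, Phi_ i \is monic)
    (Phi_i_deg : forall i, deg (Phi_ i) = d)
    (Phi_i_incr : forall i j, (i < j)%N ->
       nu (evchi iota chi (Phi_ i)) < nu (evchi iota chi (Phi_ j)))
    (Phi_i_cofinal : forall g : G, values nu (Kchi iota chi) g ->
       exists i, (Some g : withinf G) <= nu (evchi iota chi (Phi_ i)))
    (Phi_i_gt : forall i,
       nu (evchi iota chi Phi) < nu (evchi iota chi (Phi_ i))) :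
  [/\ [/\ immediate_key_degree iota chi nu d,
          w_key_polynomial iota chi nu Phi,
          w_key_polynomial iota chi nu' Phi &
          forall f : {poly K}, lt_extdeg iota chi (deg f) ->
            nu' (evchi iota chi f) = nu_sub iota chi nu' Phi f],
      (forall i, key_polynomial iota chi nu (Phi_ i)) /\
      (forall f : {poly K}, lt_extdeg iota chi (deg f) ->
         exists n, forall i, (n <= i)%N ->
           nu_sub iota chi nu (Phi_ i) f = nu (evchi iota chi f)),
      dense nu (Kchi iota chi) (Kchi_le iota chi d.-1) &
      forall e : nat, (d < e)%N -> ~ key_degree iota chi nu e].
Proof.
pose w f := nu (evchi iota chi f); pose w' f := nu' (evchi iota chi f).
pose N := lt_extdeg iota chi.
have N_le := @lt_extdeg_le K L iota chi.
have pm_w : pm_poly N w by apply: pm_poly_of.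
have pm_w' : pm_poly N w' by apply: pm_poly_of.
have d_gt0 : (0 < d)%N by apply: ltnW.
have w'_le f : w' f <= w f by apply/nu'_le/ev_Kchi.
have w'_eq f : (deg f < d)%N -> w' f = w f.
  by move=> df; apply/nu'_eq/Kchi_le_ev.
have cofinal f : w f <> None -> exists i, w f <= w (Phi_ i).
  case wf : (w f) => [g|] // _; apply: Phi_i_cofinal.
  by exists (evchi iota chi f); first exact: ev_Kchi.
have limit P : P \is monic -> deg P = d ->
    exists2 s, (deg s < d)%N & w s = w P.
  move=> mP dP; have NP : N (deg P) by rewrite dP.
  case wP : (w P) => [g|]; last by case: (pm_notNone pm_w NP (monic_neq0 mP)).
  have : values nu (Kchi_le iota chi d.-1) g.
    rewrite -chid_limit; exists (evchi iota chi P) => //.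
    (* P(chi) is chi^d minus the value at chi of X^d - P, which has degree less than [d]. *)
    exists (evchi iota chi ('X^d - P)); last by rewrite evD evN evXn subKr.
    apply: Kchi_le_ev => //; rewrite -opprB degN -[X in (_ < X)%N](degXn K d).
    by apply: deg_monicB; rewrite ?monicXn // degXn.
  case=> _ [s ds <-] ws; exists s => //.
  by rewrite -(prednK d_gt0) ltnS.
have w'lt := w'_Phi_lt N_le pm_w pm_w' d_gt0 d_lt w'_eq Phi_monic Phi_deg
  nu'_Phi Phi_i_monic Phi_i_deg Phi_i_gt.
have key P (mP : P \is monic) (dP : deg P = d) (lt : w' P < w P) :=
  w_key N_le pm_w pm_w' d_gt0 d_lt w'_le w'_eq mP dP lt.
have keyP P : P \is monic -> deg P = d -> w' P < w P ->
    key_polynomial iota chi nu P.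
  move=> mP dP lt; split; rewrite ?dP // => f g f0 g0 df dg Nfg.
  by have [] := key P mP dP lt f g f0 g0 df dg Nfg.
have M_sub := @Kchi_le_sub K L iota chi d.-1.
split.
- split.
  + split; first by exists Phi => //; apply: keyP.
    (* By the limit assumption these are the values of the module itself. *)
    rewrite chid_limit; apply: no_greatest => //.
    exact: Kchi_le_submodule.
  + split; rewrite ?Phi_deg // => f g f0 g0 df dg Nfg.
    by have [] := key Phi Phi_monic Phi_deg nu'_Phi f g f0 g0 df dg Nfg.
  + split; rewrite ?Phi_deg // => f g f0 g0 df dg Nfg.
    by have [] := key Phi Phi_monic Phi_deg nu'_Phi f g f0 g0 df dg Nfg.
  + exact: (w'_poly_sub N_le pm_w pm_w' d_gt0 d_lt).
- split=> [i|f Nf]; first exact: keyP.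
  have [n Hn] := eventually_modp N_le pm_w pm_w' d_gt0 d_lt w'_le w'_eq d_ge2
    Phi_monic Phi_deg nu'_Phi Phi_i_monic Phi_i_deg Phi_i_incr cofinal Phi_i_gt
    limit Nf.
  by exists n => i /Hn [].
- split=> // _ /Kchi_repr[f Nf <-].
  apply/seteqP; split=> g.
  + case=> _ [_ [x dx <-] <-]; rewrite -evN -evD => wfx.
    (* The degree of [f - x] is less than [d] or at most deg f. *)
    have Nfx : N (deg (f - x)).
      have [fd|df] := ltnP (deg f) d.
        apply: N_le d_lt; apply: ltnW; apply: deg_ltB => //.
        by rewrite -(prednK d_gt0) ltnS.
      apply: N_le Nf; rewrite -ltnS; apply: deg_ltB => //.
      by rewrite ltnS; apply: leq_trans df; apply: leq_trans dx (leq_pred d).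
    have [s ds ws] := value_attained N_le pm_w pm_w' d_gt0 d_lt w'_le w'_eq
      d_ge2 Phi_monic Phi_deg nu'_Phi Phi_i_monic Phi_i_deg Phi_i_incr cofinal
      Phi_i_gt limit Nfx.
    by exists (evchi iota chi s); [apply: Kchi_le_ev | exact: etrans ws wfx].
  + case=> _ [x dx <-] wx.
    have {}dx : (deg x < d)%N by rewrite -(prednK d_gt0) ltnS.
    have x0 : x != 0.
      by apply/eqP => x0; move: wx; rewrite -/(w x) x0; case: pm_w => ->.
    have [t dt wt] := value_approx N_le pm_w pm_w' d_gt0 d_lt w'_le w'_eq
      d_ge2 Phi_monic Phi_deg nu'_Phi Phi_i_monic Phi_i_deg Phi_i_incr cofinal
      Phi_i_gt limit Nf dx x0.
    exists (evchi iota chi (f - t)); last exact: etrans wt wx.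
    exists (evchi iota chi t); last by rewrite evD evN.
    exact: Kchi_le_ev.
- move=> e lte [P [mP dP NP Pkey] degP]; rewrite -degP in lte.
  have [f [g [f0 g0 df dg [degfg]]]] := no_larger_key N_le pm_w pm_w' d_gt0 d_lt
    w'_le w'_eq d_ge2 Phi_monic Phi_deg nu'_Phi Phi_i_monic Phi_i_deg Phi_i_incr
    cofinal Phi_i_gt limit mP lte NP.
  (* For this product the key polynomial condition demands the opposite strict inequality. *)
  rewrite leNgt => /negP; apply; have [|e1 e2] := Pkey f g f0 g0 df dg.
    by rewrite degfg.
  by rewrite /w e1.
Qed.
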